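(* There exists a positive constant $c$ such that $F_3(r,5,6)\ge 2^{c\log^2 r}$ for all positive integers $r$.
   Context: Logarithms are base 2. $F_3(r,5,6)$ is the minimum integer $n$ such that every coloring of the edges (triples) of the complete 3-uniform hypergraph $K_n^{(3)}$ with $r$ colors contains a set of $5$ vertices whose $10$ triples receive at most $5$ distinct colors. *)

(* Defs.v *)
From mathcomp Require Import all_boot.
From Stdlib Require Import Reals.

Set Implicit Arguments.
Unset Strict Implicit.
Unset Printing Implicit Defensive.

Definition triple_colors (n r : nat) (col : {set 'I_n} -> 'I_r) (S : {set 'I_n})
  : {set 'I_r} :=
  [set col T | T in [set T in powerset S | #|T| == 3]].

(* Arrow property defining F_3(r,5,6): every r-colouring of the triples of
   K_n^(3) (vertex set 'I_n) has a 5-set whose 10 triples receive at most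
   5 distinct colours.  Colourings are functions on all subsets; only their
   values on 3-sets are ever used. *)
Definition F3_5_6_prop (r n : nat) : Prop :=
  forall col : {set 'I_n} -> 'I_r,
    exists S : {set 'I_n}, #|S| = 5 /\ #|triple_colors col S| <= 5.

Definition log2 (x : R) : R := (ln x / ln 2)%R.

(* Main.v *)
(** Vertices are bit strings of length [n = t^2], and [delta x y] is the first
    position where [x] and [y] differ.  A triple has the form [{x, y | s}] with
    [delta x s = delta y s < delta x y].  Fix a Reed-Solomon code [E] over a field
    with [2^(2t)] elements in which distinct vertices agree in at most [t] of the
    [n] positions.  The colour of the triple records [delta x s], the bit of [x]
    there, [k = delta x y], the bit of [s] at [k], the symbol [E s k], and the bits
    of [s] at the positions where [E x] and [E y] agree: at most [2^(9t)] colours.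

    If [E b] and [E b'] agree at [delta a a'], the last component tells
    [{b, b' | a}] from [{b, b' | a'}]; otherwise [E] tells [{a, a' | b}] from
    [{a, a' | b'}].  So these two pairs are never both monochromatic, and six
    colours on five points follow by going through the shapes 3+2, (2+2)+1 and
    (3+1)+1 of the tree of first differences. *)

Require Import Defs.
From mathcomp Require Import all_boot all_algebra all_field zify.
From Stdlib Require Import Reals Lra.
(* Reals rebinds [^] in nat_scope to Nat.pow; this restores expn. *)
Import ssrnat.

Set Implicit Arguments.
Unset Strict Implicit.
Unset Printing Implicit Defensive.

Lemma widen_ord_inj m n (le_mn : m <= n) : injective (widen_ord le_mn).
Proof. by move=> i j /(congr1 (@nat_of_ord _)) eq_ij; apply: val_inj. Qed.

(** * First differences and the binary tree they span *)

Section BitStrings.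
Variable n : nat.
Implicit Types (x y z s : n.-tuple bool) (X A B : {set n.-tuple bool}) (k d : nat).

Definition bit x k : bool := nth false x k.

(** As [find] returns the length of the list on failure, equal strings have [delta] equal to [n]. *)
Definition delta x y : nat := find (fun k => bit x k != bit y k) (iota 0 n).

Lemma deltaC x y : delta x y = delta y x.
Proof. by apply: eq_find => k; rewrite eq_sym. Qed.

Lemma delta_le x y : delta x y <= n.
Proof. by rewrite -[X in _ <= X](size_iota 0) find_size. Qed.

Lemma delta_lt x y : (delta x y < n) = (x != y).
Proof.
rewrite -[X in _ < X](size_iota 0) -has_find; apply/idP/idP.
  by case/hasP => k _; apply: contraNneq => ->.
apply: contraR => /hasPn eq_xy; apply/eqP/val_inj.
apply: (@eq_from_nth _ false) => [|i]; rewrite !size_tuple // => lt_in.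
by apply/eqP; rewrite -[_ == _]negbK eq_xy // mem_iota.
Qed.

Lemma bit_delta x y : x != y -> bit x (delta x y) != bit y (delta x y).
Proof.
move=> neq_xy; have := neq_xy; rewrite -delta_lt => lt_n.
have := neq_xy; rewrite -delta_lt -[X in _ < X](size_iota 0) -has_find.
by move/(nth_find 0); rewrite -/(delta x y) nth_iota.
Qed.

Lemma bit_before_delta x y k : k < delta x y -> bit x k = bit y k.
Proof.
move=> lt_k; have lt_kn := leq_trans lt_k (delta_le x y).
by have := before_find 0 lt_k; rewrite nth_iota // => /negbFE/eqP.
Qed.

Lemma delta_eq x y k :
  bit x k != bit y k -> (forall j, j < k -> bit x j = bit y j) -> delta x y = k.
Proof.
move=> neq_k eq_j; have neq_xy: x != y by apply: contraNneq neq_k => ->.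
case: (ltngtP (delta x y) k) => // [/eq_j eq_d|/bit_before_delta eq_k].
  by have := bit_delta neq_xy; rewrite eq_d eqxx.
by rewrite eq_k eqxx in neq_k.
Qed.

Lemma delta_gt x y k :
  x != y -> (forall j, j <= k -> bit x j = bit y j) -> k < delta x y.
Proof.
move=> neq_xy eq_j; rewrite ltnNge; apply/negP => /eq_j eq_d.
by have := bit_delta neq_xy; rewrite eq_d eqxx.
Qed.

(** The topmost branching of the tree: [A] and [B] are the subtrees hanging below a node at depth
    [d]. *)
Definition splits d A B : Prop :=
  [/\ d < n,
      {in A & B, forall x y, delta x y = d},
      {in A &, forall x y, x != y -> d < delta x y}
    & {in B &, forall x y, x != y -> d < delta x y}].

(** Take for [d] the least position at which [X] is not constant, and sort [X] by the bit there. By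
    minimality all earlier bits are common to [X]. The larger class is called [A], which halves the
    later case analysis. *)
Lemma split_exists X : 1 < #|X| ->
  exists d A B, [/\ splits d A B, X = A :|: B, #|A| + #|B| = #|X| & 0 < #|B| <= #|A|].
Proof.
case/card_gt1P => x0 [y0 [Xx0 Xy0 neq0]].
pose P k := [exists x in X, exists y in X, bit x k != bit y k].
have Pd : P (delta x0 y0).
  apply/existsP; exists x0; rewrite Xx0.
  by apply/existsP; exists y0; rewrite Xy0 bit_delta.
have exP : exists k, P k by exists (delta x0 y0).
case: (ex_minnP exP) => d /exists_inP[x Xx /exists_inP[y Xy neq_d]] d_min.
have eq_lt u v j : u \in X -> v \in X -> j < d -> bit u j = bit v j.
  move=> Xu Xv; apply: contraTeq => neq_j; rewrite -leqNgt; apply: d_min.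
  by apply/exists_inP; exists u => //; apply/exists_inP; exists v.
pose part b := [set u in X | bit u d == b].
have cross b : {in part b & part (~~ b), forall u v, delta u v = d}.
  move=> u v; rewrite !inE => /andP[Xu /eqP bu] /andP[Xv /eqP bv].
  by apply: delta_eq => [|j]; [rewrite bu bv; case: (b) | apply: eq_lt].
have within b : {in part b &, forall u v, u != v -> d < delta u v}.
  move=> u v; rewrite !inE => /andP[Xu /eqP bu] /andP[Xv /eqP bv] neq_uv.
  apply: delta_gt => // j; rewrite leq_eqVlt => /orP[/eqP -> | lt_j].
    by rewrite bu bv.
  exact: eq_lt.
have cover b : X = part b :|: part (~~ b).
  by apply/setP => u; rewrite !inE -andb_orr; case: (bit u d) b => [] [] /=;
     rewrite andbT.
have cardX b : #|part b| + #|part (~~ b)| = #|X|.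
  rewrite -cardsUI -cover (_ : part b :&: _ = set0) ?cards0 ?addn0 //.
  by apply/setP => u; rewrite !inE; case: (u \in X) (bit u d) b => [] [] [].
have part_gt0 b : 0 < #|part b|.
  apply/card_gt0P; have [bx | ] := eqVneq (bit x d) b.
    by exists x; rewrite inE Xx bx eqxx.
  move=> neq_b.
  exists y; move: neq_d neq_b; rewrite inE Xy.
  by case: (bit x d) (bit y d) b => [] [] [].
have [b le_b] : exists b, #|part (~~ b)| <= #|part b|.
  by case/orP: (leq_total #|part true| #|part false|); [exists false | exists true].
have lt_dn : d < n by rewrite (leq_ltn_trans (d_min _ Pd)) // delta_lt.
exists d, (part b), (part (~~ b)); split=> //; by rewrite part_gt0.
Qed.

(** The form [{x, y | s}]: [s] leaves the tree before [x] and [y] part. The test [x != y] excludes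
    degenerate triples, for which [delta x y] would be [n]. *)
Definition close x y s : bool :=
  [&& x != y, delta x s == delta y s & delta x s < delta x y].

Lemma close_uniq x y s : close x y s -> uniq [:: x; y; s].
Proof.
case/and3P => neq_xy /eqP eq_s lt_s; rewrite /= !inE negb_or neq_xy /= andbT.
by rewrite -!delta_lt -eq_s (leq_trans lt_s) ?delta_le.
Qed.

End BitStrings.

(** * Six colours on any five points, for an abstract colouring *)

Section FivePoints.
Variables (n : nat) (C : finType).
Variable c : n.-tuple bool -> n.-tuple bool -> n.-tuple bool -> C.
Implicit Types (a b e s x y : n.-tuple bool) (X A B : {set n.-tuple bool}).

(** What the colour components detect: the outer level, the inner level, the side of [x] at the
    outer level, the bit of [s] at the inner level and, for the code symbol and the trace jointly,
    one of the two pairs of a rectangle. *)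
Hypothesis c_outer : forall x y s x' y' s',
  delta x s != delta x' s' -> c x y s != c x' y' s'.
Hypothesis c_inner : forall x y s x' y' s',
  delta x y != delta x' y' -> c x y s != c x' y' s'.
Hypothesis c_side : forall x y s x' y' s', x != x' ->
  delta x s = delta x x' -> delta x' s' = delta x x' -> c x y s != c x' y' s'.
Hypothesis c_bit : forall x y s s',
  s != s' -> delta x y = delta s s' -> c x y s != c x y s'.
Hypothesis c_rectangle : forall a a' b b', a != a' -> b != b' ->
  c a a' b != c a a' b' \/ c b b' a != c b b' a'.

Definition attains X (K : {set C}) : Prop :=
  forall x y s, x \in X -> y \in X -> s \in X -> close x y s -> c x y s \in K.

Lemma six_le_card (K : {set C}) (cs : seq C) :
  uniq cs -> size cs = 6 -> all [in K] cs -> 5 < #|K|.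
Proof.
move=> uniq_cs sz /allP sub; rewrite cardE -sz; apply: uniq_leq_size => // z.
by rewrite mem_enum; apply: sub.
Qed.

(* lia is very slow when these boolean hypotheses are in its context. *)
Ltac clear_lia :=
  repeat match goal with
  | H : is_true (~~ (_ == _)) |- _ => clear H
  | H : is_true (_ \in _) |- _ => clear H
  | H : c _ _ _ = _ |- _ => clear H
  | H : attains _ _ |- _ => clear H
  end; lia.

Ltac distinct :=
  first [ exact: isT | assumption | rewrite eq_sym; assumption
        | apply: c_side; [assumption | clear_lia | clear_lia]
        | rewrite eq_sym; apply: c_side; [assumption | clear_lia | clear_lia]
        | apply: c_outer; clear_lia | apply: c_inner; clear_lia ].

(** Exhibits six colours: pairwise distinctness comes from the separation hypotheses or the context,
    membership in [K] from checking [close] on each triple. *)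
Ltac use_colours attK cs :=
  apply: (@six_le_card _ cs);
  [ rewrite /= !inE !negb_or -?andbA; repeat (apply/andP; split); distinct | by []
  | rewrite /=; repeat (apply/andP; split); rewrite //; apply: attK; rewrite //;
    (apply/and3P; split; [assumption | apply/eqP; clear_lia | clear_lia]) ].

(** The cases are the coincidences among the colours of [{b, b1 | z}] for [z] in the triple. Each
    equality loses a colour there, but by [c_rectangle] it forces a new one among the triples with
    inner pair in the [a] side. *)
Lemma six_colours_32 X K d a a1 a2 b b1 :
  attains X K -> {subset [:: a; a1; a2; b; b1] <= X} ->
  {in [:: a; a1; a2] & [:: b; b1], forall x y, delta x y = d} -> d < n ->
  d < delta a a2 -> delta a1 a2 = delta a a2 -> delta a a2 < delta a a1 ->
  a != a1 -> b != b1 -> d < delta b b1 ->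
  5 < #|K|.
Proof.
move=> attK subX cross lt_n lt_d e12 lt_a neq_a neq_b lt_b.
have crossE x y : x \in [:: a; a1; a2] -> y \in [:: b; b1] ->
    [/\ delta x y = d, delta y x = d & x != y].
  by move=> Ax By; rewrite -delta_lt (deltaC y) cross.
have [[ab ba nab] [ab1 b1a nab1]] : [/\ delta a b = d, delta b a = d & a != b] /\
    [/\ delta a b1 = d, delta b1 a = d & a != b1].
  by split; apply: crossE; rewrite !inE eqxx ?orbT.
have [[a1b ba1 na1b] [a1b1 b1a1 na1b1]] : [/\ delta a1 b = d, delta b a1 = d & a1 != b] /\
    [/\ delta a1 b1 = d, delta b1 a1 = d & a1 != b1].
  by split; apply: crossE; rewrite !inE eqxx ?orbT.
have [[a2b ba2 na2b] [a2b1 b1a2 na2b1]] : [/\ delta a2 b = d, delta b a2 = d & a2 != b] /\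
    [/\ delta a2 b1 = d, delta b1 a2 = d & a2 != b1].
  by split; apply: crossE; rewrite !inE eqxx ?orbT.
have [na2 na12] : a != a2 /\ a1 != a2.
  by rewrite -!delta_lt e12 (leq_trans lt_a) ?delta_le.
have [Xa Xa1 Xa2] : [/\ a \in X, a1 \in X & a2 \in X].
  by split; apply: subX; rewrite !inE eqxx ?orbT.
have [Xb Xb1] : b \in X /\ b1 \in X.
  by split; apply: subX; rewrite !inE eqxx ?orbT.
clear subX cross crossE.
have [eq01 | neq01] := eqVneq (c b b1 a) (c b b1 a1).
  have [|r01] := c_rectangle neq_a neq_b; last by rewrite eq01 eqxx in r01.
  have [eq02 | neq02] := eqVneq (c b b1 a) (c b b1 a2).
    have [|r02] := c_rectangle na2 neq_b; last by rewrite eq02 eqxx in r02.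
    move=> r02 r01.
    use_colours attK [:: c a a1 a2; c a a1 b; c a a1 b1; c a a2 b; c a a2 b1;
                    c b b1 a].
  move=> r01.
  use_colours attK [:: c a a1 a2; c a a1 b; c a a1 b1; c a a2 b; c b b1 a;
                  c b b1 a2].
have [eq02 | neq02] := eqVneq (c b b1 a) (c b b1 a2).
  have [r02|r02] := c_rectangle na2 neq_b; last by rewrite eq02 eqxx in r02.
  use_colours attK [:: c a a1 a2; c a a2 b; c a a2 b1; c a a1 b; c b b1 a;
                  c b b1 a1].
have [eq12 | neq12] := eqVneq (c b b1 a1) (c b b1 a2).
  have [r12|r12] := c_rectangle na12 neq_b; last by rewrite eq12 eqxx in r12.
  use_colours attK [:: c a a1 a2; c a1 a2 b; c a1 a2 b1; c a a1 b; c b b1 a;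
                  c b b1 a1].
use_colours attK [:: c a a1 a2; c a a1 b; c a a2 b; c b b1 a; c b b1 a1;
                c b b1 a2].
Qed.

(** If the two pairs part at the same depth, [c_bit] yields four colours inside the four points and
    two more involve [e]. Otherwise [c_rectangle] yields only three, but [{a, a1 | e}] and
    [{b, b1 | e}] now differ in inner level. *)
Lemma six_colours_22 X K d d1 a a1 b b1 e :
  attains X K -> {subset [:: a; a1; b; b1; e] <= X} ->
  {in [:: a; a1; b; b1], forall x, delta x e = d} ->
  {in [:: a; a1] & [:: b; b1], forall x y, delta x y = d1} ->
  d < d1 -> d1 < n -> d1 < delta a a1 -> d1 < delta b b1 ->
  a != a1 -> b != b1 ->
  5 < #|K|.
Proof.
move=> attK subX crosse cross lt_d lt_n lt_a lt_b neq_a neq_b.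
have crossE x y : x \in [:: a; a1] -> y \in [:: b; b1] ->
    [/\ delta x y = d1, delta y x = d1 & x != y].
  by move=> Ax By; rewrite -delta_lt (deltaC y) cross.
have [[ab ba nab] [ab1 b1a nab1]] : [/\ delta a b = d1, delta b a = d1 & a != b] /\
    [/\ delta a b1 = d1, delta b1 a = d1 & a != b1].
  by split; apply: crossE; rewrite !inE eqxx ?orbT.
have [[a1b ba1 na1b] [a1b1 b1a1 na1b1]] :
    [/\ delta a1 b = d1, delta b a1 = d1 & a1 != b] /\
    [/\ delta a1 b1 = d1, delta b1 a1 = d1 & a1 != b1].
  by split; apply: crossE; rewrite !inE eqxx ?orbT.
have [ae a1e] : delta a e = d /\ delta a1 e = d.
  by rewrite !crosse ?inE ?eqxx ?orbT.
have [be b1e] : delta b e = d /\ delta b1 e = d.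
  by rewrite !crosse ?inE ?eqxx ?orbT.
have [Xa Xa1] : a \in X /\ a1 \in X.
  by split; apply: subX; rewrite !inE eqxx ?orbT.
have [Xb Xb1 Xe] : [/\ b \in X, b1 \in X & e \in X].
  by split; apply: subX; rewrite !inE eqxx ?orbT.
clear subX cross crosse crossE.
have [eq_ab | neq_ab] := eqVneq (delta a a1) (delta b b1).
  have neq1 : c a a1 b != c a a1 b1 by apply: c_bit.
  have neq2 : c b b1 a != c b b1 a1 by apply: c_bit.
  use_colours attK [:: c a a1 b; c a a1 b1; c b b1 a; c b b1 a1; c a a1 e; c a b e].
move/eqP: neq_ab => neq_ab.
have [neq1 | neq1] := c_rectangle neq_a neq_b.
  use_colours attK [:: c a a1 b; c a a1 b1; c b b1 a; c a a1 e; c b b1 e; c a b e].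
use_colours attK [:: c a a1 b; c b b1 a; c b b1 a1; c a a1 e; c b b1 e; c a b e].
Qed.

(** The four levels [d], [d1], [delta a a2], [delta a a1] increase strictly, and each of their six
    pairs occurs as the outer and inner level of some triple. *)
Lemma six_colours_31 X K d d1 a a1 a2 b e :
  attains X K -> {subset [:: a; a1; a2; b; e] <= X} ->
  {in [:: a; a1; a2; b], forall x, delta x e = d} ->
  {in [:: a; a1; a2], forall x, delta x b = d1} ->
  d < d1 -> d1 < delta a a2 ->
  delta a1 a2 = delta a a2 -> delta a a2 < delta a a1 -> a != a1 ->
  5 < #|K|.
Proof.
move=> attK subX crosse crossb lt_d lt_d1 e12 lt_a neq_a.
have neq_a2 : a != a2 by rewrite -delta_lt (leq_trans lt_a) ?delta_le.
have [ae a1e] : delta a e = d /\ delta a1 e = d.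
  by rewrite !crosse ?inE ?eqxx ?orbT.
have [a2e be] : delta a2 e = d /\ delta b e = d.
  by rewrite !crosse ?inE ?eqxx ?orbT.
have [ab a1b a2b] : [/\ delta a b = d1, delta a1 b = d1 & delta a2 b = d1].
  by rewrite !crossb ?inE ?eqxx ?orbT.
have neq_ab : a != b.
  by rewrite -delta_lt ab (leq_trans lt_d1) ?delta_le.
have [Xa Xa1 Xa2] : [/\ a \in X, a1 \in X & a2 \in X].
  by split; apply: subX; rewrite !inE eqxx ?orbT.
have [Xb Xe] : b \in X /\ e \in X.
  by split; apply: subX; rewrite !inE eqxx ?orbT.
clear subX crosse crossb.
use_colours attK [:: c a a1 a2; c a a1 b; c a a2 b; c a a1 e; c a a2 e; c a b e].
Qed.

Lemma split_three A : #|A| = 3 -> exists a a1 a2, [/\ A = [set a; a1; a2], a != a1,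
  delta a1 a2 = delta a a2 & delta a a2 < delta a a1].
Proof.
move=> cardA; have [|d [B [D [[_ cross inB _] eqA sum le_DB]]]] := @split_exists _ A.
  by rewrite cardA.
have /cards2P[a [a1 [neq_a eqB]]] : #|B| == 2 by lia.
have /cards1P[a2 eqD] : #|D| == 1 by lia.
have [Ba Ba1 Da2] : [/\ a \in B, a1 \in B & a2 \in D].
  by rewrite eqB eqD !inE !eqxx orbT.
exists a, a1, a2; split=> //; rewrite ?(cross a a2) ?(cross a1 a2) //.
  by rewrite eqA eqB eqD.
exact: inB.
Qed.

Lemma five_points X K : #|X| = 5 -> attains X K -> 5 < #|K|.
Proof.
move=> cardX attK.
have [|d [A [B [[lt_dn cross inA inB] eqX sum le_BA]]]] := @split_exists _ X.
  by rewrite cardX.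
have [eq2 | eq1] : #|B| = 2 \/ #|B| = 1 by lia.
  have /split_three[a [a1 [a2 [eqA neq_a e12 lt_a]]]] : #|A| = 3 by lia.
  have /cards2P[b [b1 [neq_b eqB]]] : #|B| == 2 by rewrite eq2.
  have neq2 : a != a2 by rewrite -delta_lt (leq_trans lt_a) ?delta_le.
  have sA z : (z \in [:: a; a1; a2]) = (z \in A) by rewrite eqA !inE orbA.
  have sB z : (z \in [:: b; b1]) = (z \in B) by rewrite eqB !inE.
  apply: (@six_colours_32 X K d a a1 a2 b b1) => //.
  - by move=> z; rewrite eqX in_setU -sA -sB -mem_cat.
  - by move=> x y; rewrite sA sB; apply: cross.
  - by apply: inA => //; rewrite eqA !inE eqxx ?orbT.
  - by apply: inB => //; rewrite eqB !inE eqxx ?orbT.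
have /cards1P[e eqB] : #|B| == 1 by rewrite eq1.
have Be : e \in B by rewrite eqB inE.
(* The side with four points branches again, strictly below depth [d]. *)
have [|d1 [P [Q [[lt_d1n cross1 inP inQ] eqA sum1 le_QP]]]] := @split_exists _ A.
  by lia.
have lt_d1 : d < d1.
  have /card_gt0P[y Qy] : 0 < #|Q| by lia.
  have /card_gt0P[x Px] : 0 < #|P| by lia.
  rewrite -(cross1 x y) //; apply: inA; rewrite ?eqA ?inE ?Px ?Qy ?orbT //.
  by rewrite -delta_lt cross1.
have [eqQ2 | eqQ1] : #|Q| = 2 \/ #|Q| = 1 by lia.
  have /cards2P[a [a1 [neq_a eq_P]]] : #|P| == 2 by lia.
  have /cards2P[b [b1 [neq_b eqQ]]] : #|Q| == 2 by rewrite eqQ2.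
  have sP z : (z \in [:: a; a1]) = (z \in P) by rewrite eq_P !inE.
  have sQ z : (z \in [:: b; b1]) = (z \in Q) by rewrite eqQ !inE.
  have sA z : (z \in [:: a; a1; b; b1]) = (z \in A) by rewrite eqA in_setU -sP -sQ -mem_cat.
  apply: (@six_colours_22 X K d d1 a a1 b b1 e) => //.
  - by move=> z; rewrite (mem_cat z [:: a; a1; b; b1] [:: e]) sA eqX eqB !inE.
  - by move=> x; rewrite sA => Ax; apply: cross.
  - by move=> x y; rewrite sP sQ; apply: cross1.
  - by apply: inP => //; rewrite eq_P !inE eqxx ?orbT.
  - by apply: inQ => //; rewrite eqQ !inE eqxx ?orbT.
have /split_three[a [a1 [a2 [eq_P neq_a e12 lt_a]]]] : #|P| = 3 by lia.
have /cards1P[b eqQ] : #|Q| == 1 by rewrite eqQ1.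
have neq2 : a != a2 by rewrite -delta_lt (leq_trans lt_a) ?delta_le.
have sP z : (z \in [:: a; a1; a2]) = (z \in P) by rewrite eq_P !inE orbA.
have sA z : (z \in [:: a; a1; a2; b]) = (z \in A).
  by rewrite (mem_cat z [:: a; a1; a2] [:: b]) sP eqA eqQ !inE.
apply: (@six_colours_31 X K d d1 a a1 a2 b e) => //.
- by move=> z; rewrite (mem_cat z [:: a; a1; a2; b] [:: e]) sA eqX eqB !inE.
- by move=> x; rewrite sA => Ax; apply: cross.
- by move=> x; rewrite sP => Px; apply: cross1; rewrite // eqQ inE.
- by apply: inP => //; rewrite eq_P !inE eqxx ?orbT.
Qed.

End FivePoints.

(** * The concrete colouring and its separation properties *)

Section Colouring.
Variables (n t : nat) (F : finType) (E : n.-tuple bool -> nat -> F).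
Implicit Types (a b s x y : n.-tuple bool).

Definition agreement x y : seq nat := [seq k <- iota 0 n | E x k == E y k].

Hypothesis agreement_le : forall x y, x != y -> size (agreement x y) <= t.

(* Positions beyond the end of [agreement x y] read the junk bit [bit s 0]. *)
Definition trace x y s : t.-tuple bool :=
  [tuple bit s (nth 0 (agreement x y) i) | i < t].

(** Levels lie in ['I_n.+1] because [delta] can equal [n]; hence [inord] loses no information. *)
Definition colour : predArgType :=
  ('I_n.+1 * bool * 'I_n.+1 * bool * F * t.-tuple bool)%type.

Definition col3 x y s : colour :=
  (inord (delta x s), bit x (delta x s), inord (delta x y), bit s (delta x y),
   E s (delta x y), trace x y s).

Lemma col3_inj x y s x' y' s' : col3 x y s = col3 x' y' s' ->
  [/\ delta x s = delta x' s', bit x (delta x s) = bit x' (delta x' s'),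
      delta x y = delta x' y', bit s (delta x y) = bit s' (delta x' y')
    & E s (delta x y) = E s' (delta x' y') /\ trace x y s = trace x' y' s'].
Proof.
case=> eq1 eq2 eq3 eq4 eq5 eq6; split=> //; last by split=> //; apply: val_inj.
  by have /(congr1 (@nat_of_ord _)) := eq1; rewrite !inordK ?ltnS ?delta_le.
by have /(congr1 (@nat_of_ord _)) := eq3; rewrite !inordK ?ltnS ?delta_le.
Qed.

(** The recorded bit of [x] lies before [delta x y], so [y] has the same one. This symmetry lets the
    colour depend on the set alone. *)
Lemma col3C x y s : close x y s -> col3 x y s = col3 y x s.
Proof.
case/and3P => neq_xy /eqP eq_s lt_s.
have trC : trace x y s = trace y x s.
  by rewrite /trace /agreement; under eq_filter do rewrite eq_sym.
by rewrite /col3 trC (deltaC y x) -eq_s (bit_before_delta lt_s).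
Qed.

Lemma col3_outer x y s x' y' s' :
  delta x s != delta x' s' -> col3 x y s != col3 x' y' s'.
Proof. by apply: contraNneq => /col3_inj[-> _ _ _ _]. Qed.

Lemma col3_inner x y s x' y' s' :
  delta x y != delta x' y' -> col3 x y s != col3 x' y' s'.
Proof. by apply: contraNneq => /col3_inj[_ _ -> _ _]. Qed.

Lemma col3_side x y s x' y' s' : x != x' ->
  delta x s = delta x x' -> delta x' s' = delta x x' -> col3 x y s != col3 x' y' s'.
Proof.
move=> /bit_delta + eq1 eq2; apply: contraNneq => /col3_inj[_ + _ _ _].
by rewrite eq1 eq2 => ->.
Qed.

Lemma col3_bit x y s s' :
  s != s' -> delta x y = delta s s' -> col3 x y s != col3 x y s'.
Proof.
move=> /bit_delta + eq_d; apply: contraNneq => /col3_inj[_ _ _ + _].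
by rewrite eq_d => ->.
Qed.

Lemma col3_rectangle a a' b b' : a != a' -> b != b' ->
  col3 a a' b != col3 a a' b' \/ col3 b b' a != col3 b b' a'.
Proof.
move=> neq_a neq_b; have [eq_b|] := eqVneq (col3 a a' b) (col3 a a' b'); last by left.
right; apply: contraNneq (bit_delta neq_a) => /col3_inj[_ _ _ _ [_ eq_tr]].
have [_ _ _ _ [eqE _]] := col3_inj eq_b.
have Zk : delta a a' \in agreement b b'.
  by rewrite mem_filter eqE eqxx mem_iota delta_lt.
(* The agreement bound ensures that a trace of length [t] reaches this position, where [a] and [a']
   differ. *)
have lt_i : index (delta a a') (agreement b b') < t.
  by rewrite (leq_trans _ (agreement_le neq_b)) // index_mem.
by have /(congr1 (fun w => tnth w (Ordinal lt_i))) := eq_tr;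
   rewrite !tnth_mktuple /= nth_index // => ->.
Qed.

(** Picks any presentation [{x, y | s}] of [T]; the default serves only sets that have none. *)
Definition col (T : {set n.-tuple bool}) : colour :=
  let x0 := [tuple of nseq n false] in
  let p := odflt (x0, x0, x0) [pick p : n.-tuple bool * n.-tuple bool * n.-tuple bool |
    close p.1.1 p.1.2 p.2 && (T == [set p.1.1; p.1.2; p.2])] in
  col3 p.1.1 p.1.2 p.2.

(** Presentations are unique up to exchanging [x] and [y]: another choice of [s] would contradict
    that the pair [x], [y] parts strictly later than the other two pairs. The exchange is
    [col3C]. *)
Lemma colE x y s : close x y s -> col [set x; y; s] = col3 x y s.
Proof.
move=> cl; rewrite /col; case: pickP => [[[u v] w] /= | /(_ (x, y, s))]; last first.
  by rewrite /= cl eqxx.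
case/andP => cl' /eqP eqT.
have := close_uniq cl; have := close_uniq cl'; rewrite /= !inE !negb_or !andbT.
move=> /andP[/andP[nuv nuw] nvw] /andP[/andP[nxy nxs] nys].
have mem z : z \in [:: u; v; w] -> z \in [:: x; y; s].
  by rewrite !inE !orbA; have /setP/(_ z) := eqT; rewrite !inE => ->.
have := mem u; have := mem v; have := mem w; rewrite !inE !eqxx ?orbT.
move: cl cl' => /[dup] cl /and3P[_ /eqP d1 d2] /and3P[_ /eqP e1 e2].
do 3![move=> /(_ isT)/or3P[]/eqP ?]; subst => //; try by rewrite eqxx in nuv.
all: try by rewrite eqxx in nuw.
all: try by rewrite eqxx in nvw.
all: rewrite ?(col3C cl) //.
all: move: d1 d2 e1 e2; rewrite ?(deltaC y x) ?(deltaC s x) ?(deltaC s y); lia.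
Qed.

Lemma card_colour : #|{: colour}| = n.+1 * 2 * n.+1 * 2 * #|F| * 2 ^ t.
Proof. by rewrite /colour !card_prod !card_ord card_bool card_tuple card_bool. Qed.

Lemma not_F3_5_6_prop r N : #|{: colour}| <= r -> N <= 2 ^ n -> ~ F3_5_6_prop r N.
Proof.
move=> le_r le_N; have le_N' : N <= #|{: n.-tuple bool}| by rewrite card_tuple card_bool.
pose v (i : 'I_N) : n.-tuple bool := enum_val (widen_ord le_N' i).
have v_inj : injective v by move=> i j /enum_val_inj/widen_ord_inj.
pose g (z : colour) : 'I_r := widen_ord le_r (enum_rank z).
have g_inj : injective g by move=> z w /widen_ord_inj/enum_rank_inj.
case/(_ (fun T : {set 'I_N} => g (col (v @: T)))) => S [cardS]; apply/negP; rewrite -ltnNge.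
set W := triple_colors _ S.
(* The colours seen on [S] are pulled back along the injection [g], so that [five_points] applies
   and its bound transfers to [W]. *)
have attS : attains col3 (v @: S) [set z | g z \in W].
  move=> _ _ _ /imsetP[i Si ->] /imsetP[j Sj ->] /imsetP[k Sk ->] cl.
  rewrite inE; apply/imsetP; exists [set i; j; k]; last first.
    by rewrite !imsetU !imset_set1 colE.
  rewrite !inE; apply/andP; split.
    by apply/subsetP => z; rewrite !inE => /orP[/orP[]|] /eqP ->.
  have /card_uniqP := close_uniq cl; rewrite /= => <-.
  rewrite -(card_imset _ v_inj) !imsetU !imset_set1.
  by apply/eqP/eq_card => z; rewrite !inE orbA.
apply: (leq_trans (five_points col3_outer col3_inner col3_side col3_bit col3_rectangle
                    _ attS)); first by rewrite card_imset.
rewrite -(card_imset _ g_inj); apply/subset_leq_card/subsetP => _ /imsetP[z + ->].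
by rewrite inE.
Qed.

End Colouring.

(** * The Reed-Solomon code *)

Section ReedSolomon.
Local Open Scope ring_scope.
Import GRing.Theory.

(** A string of [t^2] bits fits into [t] symbols of [2t] bits, read as the coefficients of a
    polynomial of degree below [t]. It is evaluated at the first [t^2] elements of [F]; two distinct
    polynomials agree at fewer than [t] points. *)
Lemma reed_solomon (t : nat) : (0 < t)%N ->
  exists (F : finType) (E : (t ^ 2).-tuple bool -> nat -> F),
    #|F| = (2 ^ (t * 2))%N /\ forall x y, x != y -> (size (agreement E x y) <= t)%N.
Proof.
move=> t_gt0; have [|F _ cardF] := @pPrimePowerField 2 (t * 2) isT; first by lia.
have le_msg : (#|{: (t ^ 2).-tuple bool}| <= #|{: t.-tuple F}|)%N.
  rewrite !card_tuple card_bool cardF -expnM leq_exp2l //; nia.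
pose msg (x : (t ^ 2).-tuple bool) : t.-tuple F := enum_val (widen_ord le_msg (enum_rank x)).
have msg_inj : injective msg.
  by move=> x y /enum_val_inj/widen_ord_inj/enum_rank_inj.
exists F, (fun x k => (Poly (msg x)).[nth 0 (enum F) k]); split=> // x y neq_xy.
set Z := agreement _ x y; pose p := Poly (msg x) - Poly (msg y).
have p_neq0 : p != 0.
  apply: contra neq_xy; rewrite subr_eq0 => /eqP eq_p; apply/eqP/msg_inj/val_inj.
  apply: (@eq_from_nth _ 0) => [|i _]; rewrite ?size_tuple //.
  by rewrite -[LHS]coef_Poly eq_p coef_Poly.
have size_p : (size p <= t)%N.
  rewrite (leq_trans (size_polyD _ _)) // size_polyN geq_max.
  by rewrite !(leq_trans (size_Poly _)) ?size_tuple.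
(* Since [t^2 <= 2^(2t)], no position runs past the enumeration of [F], so the evaluation points are
   distinct. *)
have Z_lt k : k \in Z -> (k < size (enum F))%N.
  rewrite mem_filter mem_iota -cardE cardF => /andP[_ /= lt_k].
  rewrite (leq_trans lt_k) // expnM leq_sqr; exact/ltnW/ltn_expl.
rewrite -(size_map (nth 0 (enum F))) (leq_trans _ size_p) // ltnW //.
apply: max_poly_roots => //.
  apply/allP => _ /mapP[k + ->]; rewrite mem_filter => /andP[/eqP eq_k _].
  by rewrite /root hornerD hornerN eq_k subrr.
rewrite map_inj_in_uniq ?filter_uniq ?iota_uniq // => k l /Z_lt lt_k /Z_lt lt_l /eqP.
by rewrite nth_uniq ?enum_uniq // => /eqP.
Qed.

End ReedSolomon.

(** * Counting colours and passing to logarithms *)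

Lemma F3_5_6_gt (t r N : nat) : 0 < t -> 2 ^ (9 * t) <= r -> F3_5_6_prop r N -> 2 ^ (t ^ 2) < N.
Proof.
move=> t_gt0 le_r propN; rewrite ltnNge; apply/negP => le_N.
have [F [E [cardF agrE]]] := reed_solomon t_gt0.
apply: (not_F3_5_6_prop agrE _ le_N propN); apply: leq_trans le_r.
rewrite card_colour cardF.
have le_t : (t ^ 2).+1 <= 2 ^ (t * 2).
  have := ltn_expl t (isT : 1 < 2); rewrite expnM; nia.
(* One summand per colour component: [2t] for each level and for the code symbol, [t] for each bit
   and for the trace. *)
have -> : 9 * t = t * 2 + t + t * 2 + t + t * 2 + t by lia.
have le_2 : 2 <= 2 ^ t by rewrite -[X in X <= _]expn1 leq_exp2l.
by rewrite !expnD !leq_mul.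
Qed.

(** Settles small [r], for which the construction has no positive [t]. *)
Lemma F3_5_6_ge5 (r N : nat) : 0 < r -> F3_5_6_prop r N -> 5 <= N.
Proof.
move=> r_gt0 /(_ (fun _ => Ordinal r_gt0))[S [<- _]].
by rewrite -[X in _ <= X]card_ord max_card.
Qed.

Lemma INR_expn2 k : INR (2 ^ k) = Rpower 2 (INR k).
Proof.
rewrite Rpower_pow; last lra.
elim: k => [|k IHk]; first by [].
by rewrite expnS mult_INR IHk.
Qed.

Lemma ln_le x y : (0 < x -> x <= y -> ln x <= ln y)%R.
Proof. by move=> x_gt0 [lt_xy | ->]; [apply/Rlt_le/ln_increasing | apply: Rle_refl]. Qed.

(* F_3(r,5,6) >= 2^{c log^2 r}: every n with the defining property of
   F_3(r,5,6) (in particular the minimum one) is at least 2^{c log^2 r}. *)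
Theorem theorem1p5 :
  exists c : R, (0 < c)%R /\
    forall r : nat, (0 < r)%N ->
      forall n : nat, F3_5_6_prop r n ->
        (Rpower 2 (c * (log2 (INR r)) ^ 2) <= INR n)%R.
Proof.
(* With [t] the largest integer such that [2^(9t) <= r], [log2 r <= 9(t + 1) <= 18t] once [t >= 1],
   and [324 = 18^2]. *)
exists (/ 324)%R; split=> [|r r_gt0 n prop_n]; first lra.
pose t := trunc_log 2 r %/ 9.
have le_tr : 2 ^ (9 * t) <= r.
  by rewrite (leq_trans _ (trunc_logP (isT : 1 < 2) r_gt0)) // leq_exp2l // mulnC leq_divM.
have lt_rt : r < 2 ^ (9 * t.+1).
  apply: leq_trans (trunc_log_ltn r (isT : 1 < 2)) _.
  by rewrite leq_exp2l // mulnC ltn_ceil.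
have ln2_gt0 : (0 < ln 2)%R by rewrite -ln_1; apply: ln_increasing; lra.
have INR_r : (1 <= INR r)%R by apply: (le_INR 1); apply/leP.
have log_ge0 : (0 <= log2 (INR r))%R.
  apply: Rmult_le_pos; last by apply/Rlt_le/Rinv_0_lt_compat.
  by rewrite -ln_1; apply: ln_le; lra.
have log_le : (log2 (INR r) <= 9 * (INR t + 1))%R.
  apply: (Rmult_le_reg_r _ _ _ ln2_gt0).
  rewrite /log2 /Rdiv Rmult_assoc Rinv_l ?Rmult_1_r; last lra.
  rewrite -S_INR (_ : 9%R = INR 9); last by rewrite /=; lra.
  rewrite -mult_INR -[X in (_ <= X)%R]ln_exp; apply: ln_le; first lra.
  by rewrite -/(Rpower _ _) -INR_expn2; apply/le_INR/leP/ltnW.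
have sq_le : (log2 (INR r) ^ 2 <= (9 * (INR t + 1)) ^ 2)%R by apply: pow_incr.
(* For [t = 0] the exponent is at most [81/324 < 1], so the bound is below [2], while [n >= 5]. *)
case: (posnP t) => [t0 | t_gt0].
  apply: Rle_trans (_ : 2 <= _)%R; last first.
    by apply: (le_INR 2); apply/leP; apply: leq_trans (F3_5_6_ge5 r_gt0 prop_n).
  rewrite -[X in (_ <= X)%R]Rpower_1; last lra.
  by apply: Rle_Rpower; first lra; move: sq_le; rewrite t0 /=; lra.
apply: Rle_trans (_ : INR (2 ^ (t ^ 2)) <= _)%R; last first.
  by apply/le_INR/leP/ltnW/(F3_5_6_gt t_gt0 le_tr).
rewrite INR_expn2; apply: Rle_Rpower; first lra.
have t_ge1 : (1 <= INR t)%R by apply: (le_INR 1); apply/leP.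
rewrite mult_INR; nra.
Qed.
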